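(* Let $(X,\mathcal A)$ be a measurable space, $\bar y\in(0,\infty]$, $k\in(0,\bar y]$, and let $\star,\lozenge\colon[0,\bar y]^2\to[0,\bar y]$ be non-decreasing fusion functions such that $\lozenge$ is left-continuous. Let $\varphi_i\colon[0,\bar y]\to[0,\bar y]$ ($i=1,2,3$) be functions such that $\varphi_1$ is non-decreasing and $\varphi_2,\varphi_3$ are increasing and right-continuous. Let $\psi_i\colon[0,\varphi_i(\bar y)]\to[0,\bar y]$ ($i=1,2,3$) be non-decreasing, with $\psi_2,\psi_3$ left-continuous. Let $\circ_i\colon[0,\bar y]^2\to[0,\bar y]$ ($i=1,2,3$) be non-decreasing such that $\varphi_i(\bar y)\circ_i\bar y\le\varphi_i(\bar y)$ for $i=1,2,3$ and $\bar y\circ_j 0=0$ for $j=2,3$. (a) Suppose that the inequality $$\psi_1\big(\varphi_1(a\star b)\circ_1(c\wedge d)\big)\ge\psi_2\big(\varphi_2(a)\circ_2 c\big)\lozenge\psi_3\big(\varphi_3(b)\circ_3 d\big)\qquad(\ast)$$ holds for all $a,b\in[0,k]$ and $c,d\in[0,\bar y]$. If $f,g\in\mathcal F^{k}_{(X,\mathcal A)}$ are comonotone on $X$ and $m\in\mathcal M_{(X,\mathcal A)}$ is such that $m(X)\le\bar y$, then $$\psi_1\big(\mathbf I_{\circ_1}(m,\varphi_1(f\star g))\big)\ge\psi_2\big(\mathbf I_{\circ_2}(m,\varphi_2(f))\big)\lozenge\psi_3\big(\mathbf I_{\circ_3}(m,\varphi_3(g))\big).\qquad(\ast\ast)$$ (b)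 Assume that $0\star k=k\star 0=0$, $\bar y\circ_1 0=0$ and $\varphi_i(0)\circ_i\bar y=0$ for $i=1,2,3$. If $(\ast\ast)$ is true for all functions $f,g\in\mathcal F^{k}_{(X,\mathcal A)}$ comonotone on $X$ and any $m\in\mathcal M_{(X,\mathcal A)}$ such that $m(X)\le\bar y$, then $(\ast)$ holds for all $a,b\in[0,k]$ and $c,d\in[0,\bar y]$.
   Context: $(X,\mathcal A)$ is a measurable space ($X$ non-empty, $\mathcal A$ a $\sigma$-algebra). $\mathcal F^{k}_{(X,\mathcal A)}$ is the set of all $\mathcal A$-measurable functions $f\colon X\to[0,k]$. $\mathcal M_{(X,\mathcal A)}$ is the set of monotone measures: set functions $m\colon\mathcal A\to[0,\infty]$ with $m(A)\le m(B)$ whenever $A\subset B$, $m(\emptyset)=0$, $m(X)>0$. $a\wedge b=\min(a,b)$. A fusion function is a binary operation $[0,\bar y]^2\to[0,\bar y]$. A function $\circ\colon Y_1\times Y_2\to[0,\infty]$ is non-decreasing if $a_1\circ a_2\le b_1\circ b_2$ whenever $a_i\le b_i$, $a_i,b_i\in Y_i$. A non-decreasing fusion function is left-continuous if it is left-continuous in each coordinate. ''Increasing'' (for functions of one variable) means strictly increasing. $f\star g$ is the pointwise operation $x\mapsto f(x)\star g(x)$, and $\varphi(f)=\varphi\circ f$ is the composition. Generalized (upper) Sugeno integral: for a measurable $f\colon X\to[0,\bar y]$ and a non-decreasing $\circ$, $$\mathbf I_{\circ}(m,f)=\sup_{t\in[0,\bar y]}\{t\circ m(\{f\ge t\})\},\qquad\{f\ge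 t\}=\{x\in X:f(x)\ge t\}.$$ Functions $f,g\colon X\to[0,\infty]$ are comonotone on $D\subset X$ if $(f(x)-f(y))(g(x)-g(y))\ge0$ for all $x,y\in D$.
   Formalization: In (a) it is additionally assumed that the integral of φ1(f⋆g) lies in [0,φ1(ȳ)], since otherwise ψ1 of it is undefined; in (b) it is additionally assumed that the σ-algebra contains a set other than ∅ and X, since the claim fails for the trivial σ-algebra. *)

(* Defs.v *)
From HB Require Import structures.
From mathcomp Require Import all_boot all_order all_algebra.
From mathcomp Require Import all_classical all_reals all_analysis.
From mathcomp Require Import measurable_realfun.

Set Implicit Arguments.
Unset Strict Implicit.
Unset Printing Implicit Defensive.

Import Order.TTheory GRing.Theory Num.Theory.
Import numFieldNormedType.Exports.
Local Open Scope classical_set_scope.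
Local Open Scope ring_scope.
Local Open Scope ereal_scope.

(* A function whose domain is an interval [0, p] of [0, +oo] is represented by
   a total function on \bar R; only its values on that interval matter, and
   every condition below is relativized to it. *)

Definition maps_itv (R : realType) (p q : \bar R) (f : \bar R -> \bar R) :=
  forall a, a \in `[0, p] -> f a \in `[0, q].

Definition nondecreasing_itv (R : realType) (p : \bar R)
    (f : \bar R -> \bar R) :=
  {in `[0, p] &, {homo f : a b / a <= b}}.

Definition increasing_itv (R : realType) (p : \bar R)
    (f : \bar R -> \bar R) :=
  {in `[0, p] &, {homo f : a b / a < b}}.

(* At a = 0 (resp. at a = p) the filter below is improper and the condition is
   vacuous. *)
Definition left_continuous_itv (R : realType) (p : \bar R)
    (f : \bar R -> \bar R) :=
  forall a, a \in `[0, p] ->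
    f x @[x --> within [set` `[0, a[ ] (nbhs a)] --> f a.

Definition right_continuous_itv (R : realType) (p : \bar R)
    (f : \bar R -> \bar R) :=
  forall a, a \in `[0, p] ->
    f x @[x --> within [set` `]a, p] ] (nbhs a)] --> f a.

Definition fusion (R : realType) (y : \bar R)
    (op : \bar R -> \bar R -> \bar R) :=
  forall a b, a \in `[0, y] -> b \in `[0, y] -> op a b \in `[0, y].

Definition nondecreasing_op (R : realType) (y : \bar R)
    (op : \bar R -> \bar R -> \bar R) :=
  forall a1 a2 b1 b2,
    a1 \in `[0, y] -> a2 \in `[0, y] -> b1 \in `[0, y] -> b2 \in `[0, y] ->
    a1 <= b1 -> a2 <= b2 -> op a1 a2 <= op b1 b2.

Definition left_continuous_op (R : realType) (y : \bar R)
    (op : \bar R -> \bar R -> \bar R) :=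
  forall c, c \in `[0, y] ->
    left_continuous_itv y (fun a => op a c) /\
    left_continuous_itv y (fun b => op c b).

(* Only the values of m on measurable sets matter. *)
Definition monotone_measure d (X : measurableType d) (R : realType)
    (m : set X -> \bar R) :=
  [/\ forall A, measurable A -> 0 <= m A,
      forall A B, measurable A -> measurable B -> A `<=` B -> m A <= m B,
      m set0 = 0
    & 0 < m setT].

Definition Fmeas d (X : measurableType d) (R : realType) (k : \bar R)
    (f : X -> \bar R) :=
  measurable_fun setT f /\ forall x, f x \in `[0, k].

(* Difference on [0, +oo] with the convention oo - oo = 0, whereas
   +oo - +oo = -oo in \bar R. Without it two equal infinite values would count
   as a strict decrease. *)
Definition ediff (R : realType) (a b : \bar R) : \bar R :=
  if a == b then 0 else a - b.

Definition comonotone_on (X : Type) (R : realType) (D : set X)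
    (f g : X -> \bar R) :=
  forall x y, D x -> D y -> 0 <= ediff (f x) (f y) * ediff (g x) (g y).

Definition usugeno (X : Type) (R : realType) (y : \bar R)
    (op : \bar R -> \bar R -> \bar R) (m : set X -> \bar R)
    (f : X -> \bar R) : \bar R :=
  ereal_sup [set op t (m [set x | t <= f x]) | t in [set` `[0, y] ]].

(* Main.v *)
(** For (a): since phi2 and phi3 are increasing and right-continuous, the
    integral of phi(f) is the supremum over a of phi(a) o m(f >= a). Left
    continuity moves psi and the lozenge inside the suprema, and comonotonicity
    makes {f >= a} and {g >= b} nested, so m takes the value
    m(f >= a) /\ m(g >= b) on their intersection, which is contained in
    {phi1(f * g) >= phi1(a * b)}; this reduces to the pointwise inequality.
    For (b): take f = a 1_A and g = b 1_B with A and B nested, the larger one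
    being the whole space (both empty if c = e = 0), and a monotone measure with
    m(A) = c, m(B) = e. *)

Require Import Defs.
From HB Require Import structures.
From mathcomp Require Import all_boot all_order all_algebra.
From mathcomp Require Import all_classical all_reals all_analysis.
From mathcomp Require Import measurable_realfun.
Import Order.TTheory GRing.Theory Num.Theory.
Import numFieldNormedType.Exports.
Local Open Scope classical_set_scope.
Local Open Scope ring_scope.
Local Open Scope ereal_scope.
Set Implicit Arguments.
Unset Strict Implicit.

Implicit Types R : realType.

(** * One-sided continuity on the extended line: suprema and superlevel sets *)

Lemma nbhs_ereal_gt R (a b : \bar R) (U : set (\bar R)) :
  a < b -> nbhs a U -> exists x, [/\ a < x, x < b & U x].
Proof.
move=> ab Ua.
have : nbhs a ([set x | x < b] `&` U) by apply: filterI Ua; exact: open_ereal_lt_ereal.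
case: a ab {Ua} => [r||] ab; last 1 first.
(* A neighbourhood of [-oo] contains an open ray below some real [M], so [M - 1] serves as
   witness. *)
- case=> M [_ /(_ (M - 1)%R%:E)]; rewrite lte_fin ltrBlDr ltrDl ltr01 => /(_ isT)[? ?].
  by exists (M - 1)%R%:E; rewrite ltNyr.
- move=> Ur; have {}Ur : \forall z \near r, z%:E < b /\ U z%:E by exact: Ur.
  have : \forall x \near r^'+, (r < x)%R /\ x%:E < b /\ U x%:E.
    by rewrite near_withinE; apply: filterS Ur => x.
  move=> /filter_ex[x [rx [xb Ux]]].
  by exists x%:E; rewrite lte_fin.
- by move: ab; rewrite ltNge leey.
Qed.

Lemma nbhs_ereal_lt R (a b : \bar R) (U : set (\bar R)) :
  a < b -> nbhs b U -> exists x, [/\ a < x, x < b & U x].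
Proof.
move=> ab Ub.
have NbNa : - b < - a by rewrite lteN2.
have [|x [bx xa Ux]] := nbhs_ereal_gt (U := [set x | U (- x)]) NbNa.
  by apply: oppe_continuous; rewrite oppeK.
by exists (- x); rewrite lteNr lteNl.
Qed.

(** If [C < h (ereal_sup S)], left-continuity gives a point [x] below the supremum with [C < h x];
    some [s] in [S] exceeds [x], and monotonicity contradicts [h s <= C]. The form with a bound [C]
    lets a two-variable operation be treated one coordinate at a time. *)
Lemma left_continuous_sup R (p C : \bar R) (h : \bar R -> \bar R) (S : set (\bar R)) :
  left_continuous_itv p h -> nondecreasing_itv p h ->
  S !=set0 -> S `<=` [set` `[0, p]] ->
  (forall s, S s -> h s <= C) -> h (ereal_sup S) <= C.
Proof.
move=> hlc hnd [s0 Ss0] Sp hC.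
have /= /[!in_itv]/= /andP[s0_ge0 _] := Sp _ Ss0.
have sup_itv : ereal_sup S \in `[0, p].
  rewrite in_itv /= (le_trans s0_ge0) ?ereal_sup_ubound//=.
  by apply: ge_ereal_sup => s /Sp /= /[!in_itv]/= /andP[].
(* Left-continuity is vacuous at 0, so the attained case is split off; an unattained supremum is
   positive. *)
have [supS|NsupS] := pselect (S (ereal_sup S)); first exact: hC.
rewrite leNgt; apply/negP => Ch.
have Cnear := hlc _ sup_itv _ (open_ereal_gt_ereal Ch).
have sup_gt0 : 0 < ereal_sup S.
  rewrite (le_lt_trans s0_ge0)// lt_neqAle ereal_sup_ubound// andbT.
  by apply/eqP => s0E; apply: NsupS; rewrite -s0E.
have [x [x0 xsup]] := nbhs_ereal_lt sup_gt0 Cnear.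
rewrite /= in_itv/= (ltW x0) xsup => /(_ isT).
have [s Ss xs] := ereal_sup_gt xsup.
apply/negP; rewrite -leNgt (le_trans _ (hC _ Ss))// hnd ?(ltW xs)//; last exact: Sp.
move: sup_itv; rewrite !in_itv/= (ltW x0) => /andP[_ supp].
by rewrite (le_trans (ltW xsup)).
Qed.

Lemma left_continuous_supE R (p : \bar R) (h : \bar R -> \bar R) (S : set (\bar R)) :
  left_continuous_itv p h -> nondecreasing_itv p h ->
  S !=set0 -> S `<=` [set` `[0, p]] ->
  h (ereal_sup S) = ereal_sup (h @` S).
Proof.
move=> hlc hnd S0 Sp; apply/eqP; rewrite eq_le; apply/andP; split.
  by apply: left_continuous_sup hlc hnd S0 Sp _ => s Ss; apply: ereal_sup_ubound; exists s.
apply: ge_ereal_sup => _ [s Ss <-]; apply: hnd; [exact: Sp| |exact: ereal_sup_ubound].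
have /= /[!in_itv]/= /andP[s_ge0 _] := Sp _ Ss.
rewrite (le_trans s_ge0) ?ereal_sup_ubound//=.
by apply: ge_ereal_sup => t /Sp /= /[!in_itv]/= /andP[].
Qed.

(* Right-continuity makes the infimum of a superlevel set of phi a minimum. *)
Lemma superlevel_set_itv R (p t : \bar R) (phi : \bar R -> \bar R) :
  right_continuous_itv p phi -> nondecreasing_itv p phi ->
  (exists2 a, a \in `[0, p] & t <= phi a) ->
  exists2 s, s \in `[0, p] & {in `[0, p], forall a, (t <= phi a) = (s <= a)}.
Proof.
move=> rc nd [a0 a0p ta0].
pose A := [set a | a \in `[0, p] /\ t <= phi a].
have sp : ereal_inf A \in `[0, p].
  rewrite in_itv/=; apply/andP; split.
    by apply: le_ereal_inf_tmp => a [] /[!in_itv]/= /andP[].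
  apply: (@le_trans _ _ a0); first exact: ereal_inf_lbound.
  by move: a0p; rewrite in_itv/= => /andP[].
exists (ereal_inf A) => // a ap; apply/idP/idP => [ta|sa].
  exact: ereal_inf_lbound.
suff ts : t <= phi (ereal_inf A) by rewrite (le_trans ts)// nd.
have [[]//|NAs] := pselect (A (ereal_inf A)).
rewrite leNgt; apply/negP => phit.
have phinear := rc _ sp _ (open_ereal_lt_ereal phit).
(* Strictness leaves room for a point [x] between the infimum and [a0] with [phi x < t]; an element
   of [A] below [x] then gives a contradiction. *)
have slt : ereal_inf A < a0.
  rewrite lt_neqAle ereal_inf_lbound// andbT.
  by apply/eqP => sE; apply: NAs; rewrite sE.
have [x [sx xa0]] := nbhs_ereal_gt slt phinear.
have xp : x <= p by move: a0p; rewrite in_itv/= => /andP[_]; apply: le_trans; exact: ltW.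
rewrite /= in_itv/= sx xp => /(_ isT).
have [b [bp tb] bx] := ereal_inf_lt sx.
apply/negP; rewrite -leNgt (le_trans tb)// nd ?(ltW bx)//.
move: sp; rewrite !in_itv/= xp => /andP[s0 _].
by rewrite (le_trans s0) ?ltW.
Qed.

(** * Change of level in the Sugeno integral *)

Lemma superlevel_measurable d (X : measurableType d) R (k a : \bar R) (f : X -> \bar R) :
  Fmeas k f -> measurable [set x | a <= f x].
Proof.
case=> mf _; rewrite (_ : [set x | _] = [set: X] `&` f @^-1` [set` `[a, +oo]]).
  exact/mf/emeasurable_itv.
by apply/seteqP; split => x /=; rewrite in_itv/= leey andbT => // -[].
Qed.

(** Levels are reparametrised by [phi]. Since [phi] is strictly increasing, the level [phi a] cuts
    out the set where [a <= f x]. Conversely, a level [t] reached on [[0, k]] can be raised to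
    [phi s], with [s] the least point where [t <= phi s], without changing its superlevel set. *)
Lemma usugeno_increasing d (X : measurableType d) R (y k : \bar R) (phi : \bar R -> \bar R)
    (op : \bar R -> \bar R -> \bar R) (m : set X -> \bar R) (f : X -> \bar R) :
  0 <= k -> k <= y -> maps_itv y y phi -> increasing_itv y phi -> right_continuous_itv y phi ->
  fusion y op -> nondecreasing_op y op -> op y 0 = 0 ->
  monotone_measure m -> m setT <= y -> Fmeas k f ->
  usugeno y op m (fun x => phi (f x)) =
  ereal_sup [set op (phi a) (m [set x | a <= f x]) | a in [set` `[0, k]]].
Proof.
move=> k0 ky phim phii phirc opf opnd opy0 [m0 mmon mset0 _] mTy Ff.
have y0 : 0 <= y by exact: le_trans ky.
have my a : m [set x | a <= f x] \in `[0, y].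
  have mf := superlevel_measurable a Ff.
  by rewrite in_itv/= m0//= (le_trans _ mTy)// mmon.
have phimono : {in `[0, y] &, {mono phi : a b / a <= b}} by apply: le_mono_in.
have sub a : a \in `[0, k] -> a \in `[0, y].
  by rewrite !in_itv/= => /andP[-> /le_trans->].
have fy x : f x \in `[0, y] by apply: sub; case: Ff.
have yy : y \in `[0, y] by rewrite in_itv/= y0 lexx.
have zy : 0 \in `[0, y] by rewrite in_itv/= y0 lexx.
have op_ge0 a b : a \in `[0, y] -> b \in `[0, y] -> 0 <= op a b.
  by move=> ay b_y; have /[!in_itv]/= /andP[] := opf _ _ ay b_y.
have op0 a : a \in `[0, y] -> op a 0 <= 0.
  by move=> ay; rewrite -[leRHS]opy0 opnd//; move: ay; rewrite in_itv/= => /andP[].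
apply/eqP; rewrite eq_le; apply/andP; split; last first.
  apply: ge_ereal_sup => _ [a /sub ay <-]; apply: ereal_sup_ubound.
  exists (phi a); first exact: phim.
  congr (op _ (m _)); apply/seteqP; split => x /=; by rewrite phimono.
apply: ge_ereal_sup => _ [t ty <-].
have sup_ge0 : 0 <= ereal_sup [set op (phi a) (m [set x | a <= f x]) | a in [set` `[0, k]]].
  apply: (@le_trans _ _ (op (phi 0) (m [set x | 0 <= f x]))).
    by apply: op_ge0 (my _); exact: phim.
  by apply: ereal_sup_ubound; exists 0 => //=; rewrite in_itv/= lexx.
(* A level that [phi] does not reach on [[0, k]] has an empty superlevel set, and its term vanishes
   because [op y 0 = 0]. *)
have [ex|nex] := pselect (exists2 a, a \in `[0, k] & t <= phi a); last first.
  rewrite (_ : [set x | _] = set0) ?mset0; first exact: le_trans (op0 _ ty) sup_ge0.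
  by apply/seteqP; split => // x /= tx; apply: nex; exists (f x) => //; case: Ff.
have [a0 a0k ta0] := ex.
have [|s sy sE] := superlevel_set_itv (t := t) phirc (ltW_homo_in phii).
  by exists a0 => //; exact: sub.
have sk : s \in `[0, k].
  move: sy (a0k); rewrite !in_itv/= => /andP[-> _] /andP[_]; apply: le_trans.
  by rewrite -sE// sub.
rewrite (_ : [set x | _] = [set x | s <= f x]); last first.
  by apply/seteqP; split => x /=; rewrite sE.
apply: (@le_trans _ _ (op (phi s) (m [set x | s <= f x]))).
  by apply: opnd => //; [exact: phim|rewrite sE].
by apply: ereal_sup_ubound; exists s.
Qed.

(** * Comonotone pairs and nested sets *)

Lemma ediffC R (a b : \bar R) : ediff a b = - ediff b a.
Proof.
rewrite /ediff eq_sym; case: eqVneq => [_|]; first by rewrite oppe0.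
by case: a b => [a||] [b||] // _; rewrite -!EFinB -EFinN opprB.
Qed.

Lemma ediff_gt0 R (a b : \bar R) : b < a -> 0 < ediff a b.
Proof. by move=> ba; rewrite /ediff gt_eqF// sube_gt0. Qed.

Lemma ediff_ge0 R (a b : \bar R) : b <= a -> 0 <= ediff a b.
Proof.
rewrite le_eqVlt => /predU1P[->|/ediff_gt0/ltW//].
by rewrite /ediff eqxx.
Qed.

(** Opposite strict variations would make the product negative. When [f] ties, [g] decides the
    order, so the pair induces a total preorder on [X]. *)
Lemma comonotone_onP X R (f g : X -> \bar R) :
  comonotone_on setT f g <->
  forall u v, (f u <= f v /\ g u <= g v) \/ (f v <= f u /\ g v <= g u).
Proof.
have lt_le (h1 h2 : X -> \bar R) u v :
    comonotone_on setT h1 h2 -> h1 u < h1 v -> h2 u <= h2 v.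
  move=> /(_ v u Logic.I Logic.I) + huv; apply: contraTT; rewrite -!ltNge => hvu.
  by rewrite [ediff (h2 v) _]ediffC muleN oppe_lt0 mule_gt0 ?ediff_gt0.
split=> [fg u v|fg u v _ _].
  case: (ltgtP (f u) (f v)) => [fuv|fvu|_].
  - by left; split=> //; exact: (lt_le f g u v fg).
  - by right; split=> //; exact: (lt_le f g v u fg).
  - by case: (leP (g u) (g v)) => [|/ltW]; [left|right].
have [[fuv guv]|[fvu gvu]] := fg u v; last by rewrite mule_ge0 ?ediff_ge0.
by rewrite ediffC [ediff (g u) _]ediffC muleNN mule_ge0 ?ediff_ge0.
Qed.

(* For the total preorder induced by a comonotone pair, an up-set is determined
   by the infima of f and g on it, except possibly on the class where both are
   attained. *)
Lemma comonotone_upset_measurable d (X : measurableType d) R (f g : X -> \bar R)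
    (E : set X) :
  measurable_fun setT f -> measurable_fun setT g -> comonotone_on setT f g ->
  (forall u v, f u <= f v -> g u <= g v -> E u -> E v) -> measurable E.
Proof.
move=> mf mg /comonotone_onP fg upE.
have mfY Y : measurable Y -> measurable (f @^-1` Y).
  by move=> mY; rewrite -[X in measurable X]setTI; exact: mf.
have mgY Y : measurable Y -> measurable (g @^-1` Y).
  by move=> mY; rewrite -[X in measurable X]setTI; exact: mg.
pose al := ereal_inf (f @` E); pose be := ereal_inf (g @` E).
(* [D] holds the points strictly above one of the infima, [C] those where both values equal the
   infima. *)
pose D := f @^-1` [set` `]al, +oo]] `|` g @^-1` [set` `]be, +oo]].
pose C := f @^-1` [set al] `&` g @^-1` [set be].
have mD : measurable D by apply: measurableU; [apply: mfY|apply: mgY]; exact: emeasurable_itv.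
have mC : measurable C by apply: measurableI; [apply: mfY|apply: mgY]; exact: emeasurable_set1.
(* A point strictly above an infimum is strictly above some [u] in [E] in that coordinate, hence at
   least [u] in both by comonotonicity. *)
have DE : D `<=` E.
  move=> x [] /=; rewrite in_itv/= leey andbT => /ereal_inf_lt[_ [u Eu <-]] ux.
    have [[fux gux]|[fxu _]] := fg u x; first exact: upE Eu.
    by move: ux; rewrite ltNge fxu.
  have [[fux gux]|[_ gxu]] := fg u x; first exact: upE Eu.
  by move: ux; rewrite ltNge gxu.
have EDC x : E x -> D x \/ C x.
  move=> Ex; have alx : al <= f x by apply: ereal_inf_lbound; exists x.
  have bex : be <= g x by apply: ereal_inf_lbound; exists x.
  move: alx bex; rewrite le_eqVlt => /predU1P[alx|alx] bex; last first.
    by left; left; rewrite /= in_itv/= leey andbT.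
  move: bex; rewrite le_eqVlt => /predU1P[bex|bex]; first by right.
  by left; right; rewrite /= in_itv/= leey andbT.
(* All points of [C] share the same values of [f] and [g], so [E] contains [C] as soon as it meets
   it. *)
have [[x [Ex [fx gx]]]|EC] := pselect (exists x, E x /\ C x).
  rewrite (_ : E = D `|` C); first exact: measurableU.
  apply/seteqP; split => [z /EDC //|z [/DE //|[fz gz]]].
  by apply: upE Ex; rewrite ?fx ?fz ?gx ?gz.
rewrite (_ : E = D)//; apply/seteqP; split => // z Ez.
by have [//|Cz] := EDC _ Ez; exfalso; apply: EC; exists z.
Qed.

Lemma monotone_measure_min d (X : measurableType d) R (m : set X -> \bar R) (A B : set X) :
  monotone_measure m -> measurable A -> measurable B -> A `<=` B \/ B `<=` A ->
  Order.min (m A) (m B) = m (A `&` B).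
Proof.
move=> [_ mmon _ _] mA mB [AB|BA].
  by rewrite (setIidl AB); apply/min_idPl; exact: mmon.
by rewrite (setIidr BA); apply/min_idPr; exact: mmon.
Qed.

(** * Two-valued functions and prescribed monotone measures *)

(** Superlevel sets are the whole space up to [v], then [A] up to [u], then empty. The outer ranges
    contribute 0 by [op v y = 0] and [op y 0 = 0]; on the middle one the level [u] is best. *)
Lemma usugeno_step X R (y u v : \bar R) (op : \bar R -> \bar R -> \bar R)
    (m : set X -> \bar R) (A : set X) :
  fusion y op -> nondecreasing_op y op -> op y 0 = 0 -> op v y = 0 ->
  u \in `[0, y] -> v \in `[0, y] -> v <= u ->
  m set0 = 0 -> m A \in `[0, y] -> m setT \in `[0, y] ->
  usugeno y op m (fun x => if x \in A then u else v) = op u (m A).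
Proof.
move=> opf opnd opy0 opvy uy vy vu m0 mA mT.
have y0 : 0 <= y by move: uy; rewrite in_itv/= => /andP[]; exact: le_trans.
have yy : y \in `[0, y] by rewrite in_itv/= y0 lexx.
have zy : 0 \in `[0, y] by rewrite in_itv/= y0 lexx.
have ley (t : \bar R) : t \in `[0, y] -> t <= y by rewrite in_itv/= => /andP[].
have op_ge0 s t : s \in `[0, y] -> t \in `[0, y] -> 0 <= op s t.
  by move=> sy ty; have := opf _ _ sy ty; rewrite in_itv/= => /andP[].
have le_y0 t : t \in `[0, y] -> op t 0 <= 0.
  by move=> ty; rewrite -[leRHS]opy0 opnd// ley.
have le_vy s t : s \in `[0, y] -> t \in `[0, y] -> s <= v -> op s t <= 0.
  by move=> sy ty sv; rewrite -[leRHS]opvy opnd// ley.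
apply/eqP; rewrite eq_le; apply/andP; split.
  apply: ge_ereal_sup => _ [t ty <-].
  have [tv|vt] := leP t v.
    rewrite (_ : [set x | _] = setT).
      by rewrite (le_trans (le_vy _ _ ty mT tv)) ?op_ge0.
    by apply/seteqP; split => // x _ /=; case: ifP => // _; exact: le_trans vu.
  have [tu|ut] := leP t u.
    rewrite (_ : [set x | _] = A); first exact: opnd.
    apply/seteqP; split => x /=; last by move=> /mem_set ->.
    by case: ifPn => [/set_mem//|_]; rewrite leNgt vt.
  rewrite (_ : [set x | _] = set0); first by rewrite m0 (le_trans (le_y0 _ ty)) ?op_ge0.
  by apply/seteqP; split => // x /=; case: ifP => _; rewrite leNgt ?ut ?vt.
apply: (@le_trans _ _ (op u (m [set x | u <= if x \in A then u else v]))); last first.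
  by apply: ereal_sup_ubound; exists u.
(* If [u = v], the superlevel set at [u] is the whole space instead of [A], but [op u (m A)] is then
   at most [op v y = 0]. *)
move: vu; rewrite le_eqVlt => /predU1P[vu|vu].
  have uv x : (u <= if x \in A then u else v) = true by rewrite vu if_same lexx.
  rewrite (_ : [set x | _] = setT); last by apply/seteqP; split => // x _ /=; rewrite uv.
  by rewrite (le_trans (le_vy _ _ uy mA _)) ?vu ?op_ge0.
rewrite (_ : [set x | _] = A)//; apply/seteqP; split => x /=.
  by case: ifPn => [/set_mem//|_]; rewrite leNgt vu.
by move=> /mem_set ->.
Qed.

(** Monotone measures need not be additive: a single value [c] on all sets other than the empty one
    and the whole space is consistent. *)
Lemma exists_monotone_measure d (X : measurableType d) R (A : set X) (c e : \bar R) :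
  A <> set0 -> A <> setT -> 0 <= c -> c <= e -> 0 < e ->
  exists m : set X -> \bar R, [/\ monotone_measure m, m A = c & m setT = e].
Proof.
move=> A0 AT c0 ce e0.
exists (fun B => if `[< B = setT >] then e else if `[< B = set0 >] then 0 else c).
have T0 : [set: X] <> set0.
  by move=> T0; apply: A0; apply/seteqP; split => // x _; rewrite -T0.
split.
- split.
  + by move=> B _; do 2?case: ifP => // _; exact: ltW.
  + move=> B C _ _ BC; case: asboolP => [BT|_].
      case: asboolP => // CT; exfalso; apply: CT.
      by apply/seteqP; split => // x _; apply: BC; rewrite BT.
    case: asboolP => [_|B0]; first by do 2?case: ifP => // _; exact: ltW.
    case: asboolP => // _; case: asboolP => // C0.
    by exfalso; apply: B0; apply/seteqP; split => // x /BC; rewrite C0.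
  + by rewrite (asboolF (nesym T0)) asboolT.
  + by rewrite asboolT.
- by rewrite !asboolF.
- by rewrite asboolT.
Qed.

Lemma exists_chain_measure d (X : measurableType d) R (y c e : \bar R) (A0 : set X) :
  measurable A0 -> A0 <> set0 -> A0 <> setT ->
  0 < y -> c \in `[0, y] -> e \in `[0, y] ->
  exists (m : set X -> \bar R) (A B : set X),
    [/\ monotone_measure m /\ m setT <= y, measurable A, measurable B,
        A `<=` B \/ B `<=` A & m A = c /\ m B = e].
Proof.
move=> mA0 A00 A0T y0; rewrite !in_itv/= => /andP[c0 cy] /andP[e0 ey].
have [ce|/ltW ec] := leP c e.
  (* The whole space must have positive measure, so it cannot carry the value [e = 0]; both values
     are then 0 and both sets are taken empty. *)
  move: e0; rewrite le_eqVlt => /predU1P[e0|e0].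
    have [m [mm _ mT]] := exists_monotone_measure A00 A0T (ltW y0) (lexx y) y0.
    exists m, set0, set0; split=> //; [by rewrite mT|by left|].
    by case: (mm) => _ _ -> _; split=> //; apply/eqP; rewrite eq_le c0 e0 ce.
  have [m [mm mA mT]] := exists_monotone_measure A00 A0T c0 ce e0.
  by exists m, A0, setT; split=> //; [rewrite mT|left].
move: c0; rewrite le_eqVlt => /predU1P[c0|c0].
  have [m [mm _ mT]] := exists_monotone_measure A00 A0T (ltW y0) (lexx y) y0.
  exists m, set0, set0; split=> //; [by rewrite mT|by left|].
  by case: (mm) => _ _ -> _; split=> //; apply/eqP; rewrite eq_le e0 c0 ec.
have [m [mm mA mT]] := exists_monotone_measure A00 A0T e0 ec c0.
by exists m, setT, A0; split=> //; [rewrite mT|right].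
Qed.

Lemma Fmeas_step d (X : measurableType d) R (k a : \bar R) (A : set X) :
  measurable A -> a \in `[0, k] -> Fmeas k (fun x => if x \in A then a else 0).
Proof.
move=> mA ak; split.
  apply: measurable_fun_ifT => //; apply: (measurable_fun_bool true).
  rewrite (_ : _ `&` _ = A)//; apply/seteqP; split => x /=; first by case=> _ /set_mem.
  by move=> /mem_set.
move=> x; case: ifP => // _; move: ak; rewrite !in_itv/= lexx => /andP[].
exact: le_trans.
Qed.

Lemma comonotone_step X R (a b : \bar R) (A B : set X) :
  0 <= a -> 0 <= b -> A `<=` B \/ B `<=` A ->
  comonotone_on setT (fun x => if x \in A then a else 0) (fun x => if x \in B then b else 0).
Proof.
move=> a0 b0 AB; apply/comonotone_onP => u v.
have {}AB : (forall z, z \in A -> z \in B) \/ (forall z, z \in B -> z \in A).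
  by case: AB => sub; [left|right] => z /set_mem /sub /mem_set.
(* Membership patterns that violate the inclusion are contradictory; in all others the two functions
   vary in the same direction. *)
by case: AB => sub; move: (sub u) (sub v);
  case: (u \in A); case: (v \in A); case: (u \in B); case: (v \in B) => su sv;
  try (by have := su isT); try (by have := sv isT);
  solve [by left; rewrite ?lexx|by right; rewrite ?lexx].
Qed.

(** * Both implications between the pointwise and the integral inequality *)

Unset Implicit Arguments.
Set Strict Implicit.

Theorem theorem3p2 (R : realType) (d : measure_display) (X : measurableType d)
  (y k : \bar R)
  (star lozenge : \bar R -> \bar R -> \bar R)
  (phi1 phi2 phi3 psi1 psi2 psi3 : \bar R -> \bar R)
  (o1 o2 o3 : \bar R -> \bar R -> \bar R)
  (y_gt0 : 0 < y) (k_gt0 : 0 < k) (k_le_y : k <= y)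
  (star_fusion : fusion y star) (star_nd : nondecreasing_op y star)
  (loz_fusion : fusion y lozenge) (loz_nd : nondecreasing_op y lozenge)
  (loz_lc : left_continuous_op y lozenge)
  (phi1_maps : maps_itv y y phi1)
  (phi2_maps : maps_itv y y phi2)
  (phi3_maps : maps_itv y y phi3)
  (phi1_nd : nondecreasing_itv y phi1)
  (phi2_inc : increasing_itv y phi2) (phi2_rc : right_continuous_itv y phi2)
  (phi3_inc : increasing_itv y phi3) (phi3_rc : right_continuous_itv y phi3)
  (psi1_maps : maps_itv (phi1 y) y psi1)
  (psi2_maps : maps_itv (phi2 y) y psi2)
  (psi3_maps : maps_itv (phi3 y) y psi3)
  (psi1_nd : nondecreasing_itv (phi1 y) psi1)
  (psi2_nd : nondecreasing_itv (phi2 y) psi2)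
  (psi3_nd : nondecreasing_itv (phi3 y) psi3)
  (psi2_lc : left_continuous_itv (phi2 y) psi2)
  (psi3_lc : left_continuous_itv (phi3 y) psi3)
  (o1_fusion : fusion y o1) (o1_nd : nondecreasing_op y o1)
  (o2_fusion : fusion y o2) (o2_nd : nondecreasing_op y o2)
  (o3_fusion : fusion y o3) (o3_nd : nondecreasing_op y o3)
  (o1_le : o1 (phi1 y) y <= phi1 y)
  (o2_le : o2 (phi2 y) y <= phi2 y)
  (o3_le : o3 (phi3 y) y <= phi3 y)
  (o2_y0 : o2 y 0 = 0) (o3_y0 : o3 y 0 = 0) :
  (* part (a) *)
  ((forall a b c e : \bar R,
      a \in `[0, k] -> b \in `[0, k] -> c \in `[0, y] -> e \in `[0, y] ->
      psi1 (o1 (phi1 (star a b)) (Order.min c e)) >=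
        lozenge (psi2 (o2 (phi2 a) c)) (psi3 (o3 (phi3 b) e))) ->
   forall (f g : X -> \bar R) (m : set X -> \bar R),
     Fmeas k f -> Fmeas k g -> comonotone_on setT f g ->
     monotone_measure m -> m setT <= y ->
     (* the argument of psi1 lies in its domain [0, phi1 y]; this is not
        automatic because o1 y 0 = 0 is not assumed in this part *)
     usugeno y o1 m (fun x => phi1 (star (f x) (g x))) \in `[0, phi1 y] ->
     psi1 (usugeno y o1 m (fun x => phi1 (star (f x) (g x)))) >=
       lozenge (psi2 (usugeno y o2 m (fun x => phi2 (f x))))
               (psi3 (usugeno y o3 m (fun x => phi3 (g x))))) /\
  (* part (b) *)
  (star 0 k = 0 -> star k 0 = 0 -> o1 y 0 = 0 ->
   o1 (phi1 0) y = 0 -> o2 (phi2 0) y = 0 -> o3 (phi3 0) y = 0 ->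
   (* the sigma-algebra of X is not trivial; otherwise m takes only the values
      0 and m(X) and the hypothesis gives no information for c <> e *)
   (exists A : set X, [/\ measurable A, A <> set0 & A <> setT]) ->
   (forall (f g : X -> \bar R) (m : set X -> \bar R),
     Fmeas k f -> Fmeas k g -> comonotone_on setT f g ->
     monotone_measure m -> m setT <= y ->
     psi1 (usugeno y o1 m (fun x => phi1 (star (f x) (g x)))) >=
       lozenge (psi2 (usugeno y o2 m (fun x => phi2 (f x))))
               (psi3 (usugeno y o3 m (fun x => phi3 (g x))))) ->
   forall a b c e : \bar R,
     a \in `[0, k] -> b \in `[0, k] -> c \in `[0, y] -> e \in `[0, y] ->
     psi1 (o1 (phi1 (star a b)) (Order.min c e)) >=
       lozenge (psi2 (o2 (phi2 a) c)) (psi3 (o3 (phi3 b) e))).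

Proof.
have y_ge0 := ltW y_gt0.
have k_ge0 := ltW k_gt0.
have yy : y \in `[0, y] by rewrite in_itv/= y_ge0 lexx.
have zy : 0 \in `[0, y] by rewrite in_itv/= y_ge0 lexx.
have zk : 0 \in `[0, k] by rewrite in_itv/= k_ge0 lexx.
have kk : k \in `[0, k] by rewrite in_itv/= k_ge0 lexx.
have ky a : a \in `[0, k] -> a \in `[0, y].
  by rewrite !in_itv/= => /andP[-> /le_trans->].
have ley (t : \bar R) : t \in `[0, y] -> t <= y by rewrite in_itv/= => /andP[].
have lek (t : \bar R) : t \in `[0, k] -> t <= k by rewrite in_itv/= => /andP[].
have ge0 (p t : \bar R) : t \in `[0, p] -> 0 <= t by rewrite in_itv/= => /andP[].
(* The bound [op (phi y) y <= phi y] keeps the arguments of each [psi] inside its domain. *)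
have op_phi (phi : \bar R -> \bar R) (op : \bar R -> \bar R -> \bar R) u c :
    maps_itv y y phi -> fusion y op -> nondecreasing_op y op ->
    op (phi y) y <= phi y -> u \in `[0, y] -> u <= phi y -> c \in `[0, y] ->
    op u c \in `[0, phi y].
  move=> phim opf opnd ople uy uphi cy.
  rewrite in_itv/= (ge0 _ _ (opf _ _ uy cy))/=.
  by apply: le_trans ople; apply: opnd => //; [exact: phim|exact: ley].
have phi_nd2 := ltW_homo_in phi2_inc.
have phi_nd3 := ltW_homo_in phi3_inc.
split.
  move=> ineq f g m Ff Fg fg mm mTy I1.
  have [m_ge0 mmon m0 _] := mm.
  have mf a := superlevel_measurable a Ff.
  have mg a := superlevel_measurable a Fg.
  have my A : measurable A -> m A \in `[0, y].
    by move=> mA; rewrite in_itv/= m_ge0//= (le_trans _ mTy)// mmon.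
  have fgle := (comonotone_onP f g).1 fg.
  have fk x : f x \in `[0, k] by case: Ff.
  have gk x : g x \in `[0, k] by case: Fg.
  rewrite (usugeno_increasing k_ge0 k_le_y phi2_maps phi2_inc phi2_rc o2_fusion o2_nd)//.
  rewrite (usugeno_increasing k_ge0 k_le_y phi3_maps phi3_inc phi3_rc o3_fusion o3_nd)//.
  set S2 := [set o2 _ _ | _ in _]; set S3 := [set o3 _ _ | _ in _].
  have S2p : S2 `<=` [set` `[0, phi2 y]].
    move=> _ [a /ky ay <-] /=.
    by apply: op_phi => //; [exact: phi2_maps|exact: phi_nd2 (ley _ ay)|exact: my].
  have S3p : S3 `<=` [set` `[0, phi3 y]].
    move=> _ [a /ky ay <-] /=.
    by apply: op_phi => //; [exact: phi3_maps|exact: phi_nd3 (ley _ ay)|exact: my].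
  have S20 : S2 !=set0 by exists (o2 (phi2 0) (m [set x | 0 <= f x])); exists 0.
  have S30 : S3 !=set0 by exists (o3 (phi3 0) (m [set x | 0 <= g x])); exists 0.
  rewrite (left_continuous_supE psi2_lc psi2_nd S20 S2p).
  rewrite (left_continuous_supE psi3_lc psi3_nd S30 S3p).
  have T2y : psi2 @` S2 `<=` [set` `[0, y]] by move=> _ [s /S2p /psi2_maps ? <-].
  have T3y : psi3 @` S3 `<=` [set` `[0, y]] by move=> _ [s /S3p /psi3_maps ? <-].
  have T20 : psi2 @` S2 !=set0 by case: S20 => s Ss; exists (psi2 s); exists s.
  have T30 : psi3 @` S3 !=set0 by case: S30 => s Ss; exists (psi3 s); exists s.
  have supT3 : ereal_sup (psi3 @` S3) \in `[0, y].
    rewrite -(left_continuous_supE psi3_lc psi3_nd S30 S3p); apply: psi3_maps.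
    have [s Ss] := S30; rewrite in_itv/= (le_trans (ge0 _ _ (S3p _ Ss))) ?ereal_sup_ubound//=.
    by apply: ge_ereal_sup => t /S3p /=; rewrite in_itv/= => /andP[].
  (* The suprema leave [lozenge] one at a time: first with the second argument frozen at its
     supremum, then with the first frozen at the value [v]. *)
  apply: (left_continuous_sup (loz_lc _ supT3).1)=> //.
    by move=> a b ay b_y ab; apply: loz_nd.
  move=> _ [_ [a ak <-] <-].
  set v := psi2 _.
  have vy : v \in `[0, y] by apply: T2y; do 2?apply: imageP.
  apply: (left_continuous_sup (loz_lc _ vy).2)=> //.
    by move=> p q py qy pq; apply: loz_nd.
  move=> _ [_ [b bk <-] <-].
  apply: le_trans (ineq _ _ _ _ ak bk (my _ (mf a)) (my _ (mg b))) _.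
  have sab : star a b \in `[0, y] by apply: star_fusion; exact: ky.
  (* If [a <= f u] but [g u < b], every [w] with [b <= g w] lies strictly above [u] for [g], hence
     [f u <= f w]. *)
  have nested : [set x | a <= f x] `<=` [set x | b <= g x] \/
                [set x | b <= g x] `<=` [set x | a <= f x].
    have [|/existsNP[u /not_implyP[/= au /negP]]] :=
      pselect ([set x | a <= f x] `<=` [set x | b <= g x]).
      by left.
    rewrite -ltNge => gub; right => w /= bw.
    have [[fuw _]|[_ gwu]] := fgle u w; first exact: le_trans fuw.
    by move: (lt_le_trans gub bw); rewrite ltNge gwu.
  rewrite (monotone_measure_min mm)//.
  set E := [set x | phi1 (star a b) <= phi1 (star (f x) (g x))].
  have sfg x : star (f x) (g x) \in `[0, y] by apply: star_fusion; exact: ky.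
  (* [star] and [phi1] are only monotone, so measurability of [E] comes from its being an up-set for
     the comonotone preorder. *)
  have mE : measurable E.
    apply: (comonotone_upset_measurable (f := f) (g := g)) => //; [by case: Ff|by case: Fg|].
    move=> u w fuw guw /= /le_trans; apply; apply: phi1_nd => //.
    by apply: star_nd => //; exact: ky.
  have mI : measurable ([set x | a <= f x] `&` [set x | b <= g x]) by exact: measurableI.
  (* [I1] places the integral in the domain where [psi1] is monotone; the level [phi1 (star a b)]
     then bounds it from below. *)
  apply: psi1_nd => //.
    by apply: op_phi => //; [exact: phi1_maps|exact: phi1_nd (ley _ sab)|exact: my].
  apply: (@le_trans _ _ (o1 (phi1 (star a b)) (m E))).
    apply: o1_nd => //; [exact: phi1_maps|exact: my|exact: phi1_maps|exact: my|].
    apply: mmon => // x [/= afx bgx]; apply: phi1_nd => //.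
    by apply: star_nd => //; exact: ky.
  by apply: ereal_sup_ubound; exists (phi1 (star a b)) => //; exact: phi1_maps.
move=> s0k sk0 o1_y0 o1_0 o2_0 o3_0 [A0 [mA0 A00 A0T]] ineq a b c e ak bk cy ey.
have [m [A [B [[mm mTy] mA mB AB [mAc mBe]]]]] := exists_chain_measure mA0 A00 A0T y_gt0 cy ey.
have [m_ge0 mmon m0 _] := mm.
have my C : measurable C -> m C \in `[0, y].
  by move=> mC; rewrite in_itv/= m_ge0//= (le_trans _ mTy)// mmon.
(* Monotonicity spreads the corner values [star k 0 = 0] and [star 0 k = 0] along the edges, so
   [star] of the two step functions is a step function on the intersection of [A] and [B]. *)
have star0r s : s \in `[0, k] -> star s 0 = 0.
  move=> sk; apply/eqP; rewrite eq_le -[X in _ <= X]sk0 star_nd ?lek ?ky//=.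
  by rewrite (ge0 y)// star_fusion// ky.
have star0l s : s \in `[0, k] -> star 0 s = 0.
  move=> sk; apply/eqP; rewrite eq_le -[X in _ <= X]s0k star_nd ?lek ?ky//=.
  by rewrite (ge0 y)// star_fusion// ky.
have := ineq _ _ m (Fmeas_step mA ak) (Fmeas_step mB bk)
  (comonotone_step (ge0 _ _ ak) (ge0 _ _ bk) AB) mm mTy.
have -> : (fun x => phi1 (star (if x \in A then a else 0) (if x \in B then b else 0))) =
    (fun x => if x \in A `&` B then phi1 (star a b) else phi1 0).
  apply/funext => x; rewrite in_setI; case: (x \in A); case: (x \in B) => //=.
  - by rewrite star0r.
  - by rewrite star0l.
  - by rewrite star0r.
have -> : (fun x => phi2 (if x \in A then a else 0)) =
    (fun x => if x \in A then phi2 a else phi2 0) by apply/funext => x; case: ifP.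
have -> : (fun x => phi3 (if x \in B then b else 0)) =
    (fun x => if x \in B then phi3 b else phi3 0) by apply/funext => x; case: ifP.
have ay := ky _ ak; have b_y := ky _ bk.
have sab : star a b \in `[0, y] by exact: star_fusion.
rewrite (usugeno_step o1_fusion o1_nd o1_y0 o1_0)//; last 5 first.
- exact: phi1_maps.
- exact: phi1_maps.
- by apply: phi1_nd => //; exact: ge0 sab.
- by apply: my; exact: measurableI.
- exact: my.
rewrite (usugeno_step o2_fusion o2_nd o2_y0 o2_0)//; last 5 first.
- exact: phi2_maps.
- exact: phi2_maps.
- by apply: phi_nd2 => //; exact: ge0 ay.
- exact: my.
- exact: my.
rewrite (usugeno_step o3_fusion o3_nd o3_y0 o3_0)//; last 5 first.
- exact: phi3_maps.
- exact: phi3_maps.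
- by apply: phi_nd3 => //; exact: ge0 b_y.
- exact: my.
- exact: my.
by rewrite -(monotone_measure_min mm)// mAc mBe.
Qed.
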